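(* Let $G$ be a group, let $p$ be a prime number and let $n>0$ be an integer such that $\gcd(n,p)=1$. Then $\Gamma_G\cong\Gamma_{\mathbb{Z}_p\oplus\mathbb{Z}_p\oplus\mathbb{Z}_n}$ if and only if $G\cong\mathbb{Z}_p\oplus\mathbb{Z}_p\oplus\mathbb{Z}_n$.
   Context: A group is locally cyclic if each of its finitely generated subgroups is cyclic. For a group $G$, $Cyc(G)=\{x\in G : \langle x,y\rangle \text{ is cyclic for all } y\in G\}$. For a non locally cyclic group $G$, the non-cyclic graph $\Gamma_G$ is the simple graph with vertex set $G\setminus Cyc(G)$ in which two distinct vertices $x,y$ are adjacent if and only if $\langle x,y\rangle$ is not cyclic. $\Gamma_G\cong\Gamma_K$ means that $G$ and $K$ are non locally cyclic groups and the two graphs are isomorphic ($G$ is not assumed finite). $\mathbb{Z}_n$ is the cyclic group of order $n$. *)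

(* Defs.v *)
From mathcomp Require Import all_boot zmodp.
From mathcomp Require Import classical_sets cardinality.

Set Implicit Arguments.
Unset Strict Implicit.
Unset Printing Implicit Defensive.

Local Open Scope classical_set_scope.

(* [finGroupType] and [{group gT}] are for finite groups only; here groups are
   [groupType]s of arbitrary cardinality, with subgroups as [set]s. *)

Definition is_subgroup (G : groupType) (H : set G) : Prop :=
  H 1%g /\ forall x y : G, H x -> H y -> H (x * y^-1)%g.

Definition gen_subgroup (G : groupType) (A : set G) : set G :=
  smallest (@is_subgroup G) A.

Definition is_cyclic (G : groupType) (H : set G) : Prop :=
  exists z : G, H = gen_subgroup [set z].

Definition finitely_generated (G : groupType) (H : set G) : Prop :=
  exists2 A : set G, finite_set A & H = gen_subgroup A.

Definition locally_cyclic (G : groupType) : Prop :=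
  forall H : set G, is_subgroup H -> finitely_generated H -> is_cyclic H.

Definition Cyc (G : groupType) : set G :=
  [set x | forall y : G, is_cyclic (gen_subgroup [set x; y])].
Arguments Cyc G : clear implicits.

Record simple_graph := SimpleGraph {
  vertex :> Type;
  adj : vertex -> vertex -> Prop;
  adj_sym : forall x y : vertex, adj x y -> adj y x;
  adj_irrefl : forall x : vertex, ~ adj x x
}.

Definition graph_isomorphic (X Y : simple_graph) : Prop :=
  exists2 f : X -> Y, bijective f &
    forall x y : X, adj x y <-> adj (f x) (f y).

Definition noncyclic_adj (G : groupType) (x y : ~` Cyc G) : Prop :=
  x <> y /\ ~ is_cyclic (gen_subgroup [set val x; val y]).

Lemma noncyclic_adj_sym (G : groupType) (x y : ~` Cyc G) :
  noncyclic_adj x y -> noncyclic_adj y x.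
Proof. by move=> [xy ncxy]; split; [move/esym | rewrite setUC]. Qed.

Lemma noncyclic_adj_irrefl (G : groupType) (x : ~` Cyc G) :
  ~ noncyclic_adj x x.
Proof. by case. Qed.

Definition noncyclic_graph (G : groupType) : simple_graph :=
  SimpleGraph (@noncyclic_adj_sym G) (@noncyclic_adj_irrefl G).

(* [noncyclic_graph G] is only meaningful when [G] is not locally cyclic, so
   an isomorphism of non-cyclic graphs includes that requirement. *)
Definition noncyclic_graph_isomorphic (G K : groupType) : Prop :=
  [/\ ~ locally_cyclic G, ~ locally_cyclic K &
      graph_isomorphic (noncyclic_graph G) (noncyclic_graph K)].

Definition group_isomorphic (G K : groupType) : Prop :=
  exists2 f : G -> K, bijective f & {morph f : x y / (x * y)%g}.

(* The additive group of integers modulo [n], for [n > 0]. MathComp's ['Z_n]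
   is not usable for [n = 1], where it has two elements. The group law of
   [groupType] on ['I_m.+1] is addition modulo [m.+1]. *)
Definition Zmod (n : nat) : groupType := 'I_n.-1.+1.

(* Main.v *)
Require Import Defs.
From mathcomp Require Import boolp classical_sets functions cardinality.
From HB Require Import structures.
From mathcomp Require Import all_boot all_algebra all_fingroup all_solvable.
From mathcomp Require Import ring zify.

(** Call two elements cocyclic when a common cyclic subgroup contains them, and
    write Z for Cyc(G). In Z_p + Z_p + Z_n the elements (v, c) and (w, d) are
    cocyclic iff v and w are proportional over F_p, so the graph is complete
    multipartite with p + 1 parts of size (p - 1) n. Conversely let G have this
    graph. The complement of Z is finite and contains a coset of Z, so G is
    finite. Cocyclicity being transitive outside Z, each part together with Z
    is a subgroup, of order |Z| + (p - 1) n, and Lagrange's theorem forces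
    |Z| = n. Hence |G| = p^2 n with Z cyclic and central of order n prime to p,
    and G is the direct product of Z and of its Sylow p-subgroup, which has
    order p^2 and is not cyclic because G is not. *)

Set Implicit Arguments.
Unset Strict Implicit.
Unset Printing Implicit Defensive.

(* With (p - 1) n = k m, the second divisibility says that k + 1 divides
   1 + (p + 1) k = (p + 1) (k + 1) - p, hence p, so k = p - 1. *)
Lemma card_center_eq (p m n : nat) : prime p -> 0 < m -> 0 < n ->
    m %| m + p.-1 * n -> m + p.-1 * n %| m + (p ^ 2).-1 * n -> m = n.
Proof.
move=> p_prime m_gt0 n_gt0; rewrite dvdn_addr // => /dvdnP[k eq_k].
have p_gt1 := prime_gt1 p_prime.
have -> : (p ^ 2).-1 * n = p.+1 * (p.-1 * n).
  rewrite mulnA; congr (_ * _); rewrite -mulnn.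
  case: p p_gt1 {p_prime eq_k} => // q _; rewrite !mulSn mulnS /=; lia.
rewrite eq_k mulnA -!mulSn dvdn_pmul2r // => dvd_k.
have : k.+1 %| p.
  have -> : p = p.+1 * k.+1 - (p.+1 * k).+1 by lia.
  by rewrite dvdn_sub // dvdn_mull.
case/primeP: p_prime => _ /[apply] /orP[] /eqP.
  by move=> [k0]; move/eqP: eq_k; rewrite k0 mul0n muln_eq0; lia.
move=> eq_p; move: eq_k; rewrite -eq_p /= => /eqP.
have k_gt0: 0 < k by lia.
by rewrite eqn_pmul2l // => /eqP.
Qed.

Local Open Scope group_scope.

(** * Generated subgroups and cocyclicity in groups of any cardinality *)

Section GeneratedSubgroups.
Local Open Scope classical_set_scope.

Section Subgroup.
Variables (G : groupType) (H : set G).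
Hypothesis sgH : is_subgroup H.

Lemma subgroup1 : H 1. Proof. by case: sgH. Qed.

Lemma subgroupV x : H x -> H x^-1.
Proof. by case: sgH => H1 HM Hx; rewrite -[x^-1]mul1g; apply: HM. Qed.

Lemma subgroupM x y : H x -> H y -> H (x * y).
Proof.
by move=> Hx /subgroupV Hy; case: sgH => _ HM; rewrite -[y]invgK; apply: HM.
Qed.

Lemma subgroupX x n : H x -> H (x ^+ n).
Proof.
move=> Hx; elim: n => [|n IHn]; first exact: subgroup1.
by rewrite expgS; apply: subgroupM.
Qed.

End Subgroup.

Lemma gen_subgroupP (G : groupType) (A : set G) : is_subgroup (gen_subgroup A).
Proof.
split=> [|x y gx gy] H [sgH sAH]; first exact: (subgroup1 sgH).
by apply: (subgroupM sgH); [apply: gx | apply: (subgroupV sgH); apply: gy].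
Qed.

Lemma gen_subgroup1E (G : groupType) (z : G) :
  gen_subgroup [set z] = [set x | exists k, x = z ^+ k \/ x = z ^- k].
Proof.
have gz : gen_subgroup [set z] z by apply: sub_gen_smallest.
have sg := gen_subgroupP [set z].
apply/seteqP; split; last first.
  move=> x [k [->|->]]; first exact: (subgroupX sg).
  exact: (subgroupV sg (subgroupX sg _ gz)).
apply: smallest_sub; last by move=> _ ->; exists 1%N; left.
have frac k l : exists j, z ^+ k * z ^- l = z ^+ j \/ z ^+ k * z ^- l = z ^- j.
  case/orP: (leq_total k l) => le_kl.
    by exists (l - k)%N; right; rewrite expgnFr // invgF.
  by exists (k - l)%N; left; rewrite expgnFr.
split=> [|x y [k xk] [l yl]]; first by exists 0%N; left.
case: xk => ->; case: yl => ->; rewrite ?invgK.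
- exact: frac.
- by exists (k + l)%N; left; rewrite expgnDr.
- by exists (l + k)%N; right; rewrite expgnDr invMg.
- rewrite -(commuteV (commuteX2 l k (commute_refl z))); exact: frac.
Qed.

Definition cocyclic (G : groupType) (x y : G) : Prop :=
  exists z, gen_subgroup [set z] x /\ gen_subgroup [set z] y.

(** By Bezout, if x and y are, up to inversion, the powers of z with exponents k and l, then they
    generate the same subgroup as [z ^+ gcdn k l]. *)
Lemma cyclic_gen2P (G : groupType) (x y : G) :
  is_cyclic (gen_subgroup [set x; y]) <-> cocyclic x y.
Proof.
split=> [[z gz]|[z []]].
  by exists z; rewrite -gz; split; apply: sub_gen_smallest; [left | right].
set H := gen_subgroup [set x; y].
have sgH : is_subgroup H := gen_subgroupP _.
have Hx : H x by apply: sub_gen_smallest; left.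
have Hy : H y by apply: sub_gen_smallest; right.
rewrite gen_subgroup1E => -[k xk] [l yl].
have Hk : H (z ^+ k).
  case: xk => eqx; last rewrite -[z ^+ k]invgK; rewrite -eqx //.
  exact: subgroupV sgH _ Hx.
have Hl : H (z ^+ l).
  case: yl => eqy; last rewrite -[z ^+ l]invgK; rewrite -eqy //.
  exact: subgroupV sgH _ Hy.
have Hg : H (z ^+ gcdn k l).
  have [->|k_gt0] := posnP k; first by rewrite gcd0n.
  have [i j eq_ij _] := egcdnP l k_gt0.
  have -> : z ^+ gcdn k l = (z ^+ l ^+ j)^-1 * z ^+ k ^+ i.
    apply: (canRL (mulKg _)); rewrite -!expgnA mulnC [(k * i)%N]mulnC eq_ij.
    by rewrite expgnDr.
  by apply: (subgroupM sgH); [apply: (subgroupV sgH)|]; apply: (subgroupX sgH).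
exists (z ^+ gcdn k l); apply/seteqP; split; last first.
  by apply: smallest_sub => // _ ->.
have dvd_gen i : gcdn k l %| i -> gen_subgroup [set z ^+ gcdn k l] (z ^+ i).
  move=> /dvdnP[j ->]; rewrite mulnC expgnA gen_subgroup1E.
  by exists j; left.
apply: smallest_sub; first exact: gen_subgroupP.
move=> _ [->|->]; [case: xk => -> | case: yl => ->];
  do ?apply: (subgroupV (gen_subgroupP _));
  by apply: dvd_gen; rewrite (dvdn_gcdl, dvdn_gcdr).
Qed.

Lemma finite_groupType (G : groupType) :
  finite_set [set: G] -> exists gT : finGroupType, gT = G :> groupType.
Proof.
case: G => T c /finite_seqP[s sE]; set G : groupType := Group.Pack c.
have sP (x : G) : x \in undup s.
  by rewrite mem_undup; have : [set: G] x by []; rewrite sE.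
have cT : pcancel (index^~ (undup s)) (nth None (map some (undup s))).
  by move=> x; rewrite (nth_map x) ?nth_index ?index_mem.
have fT : Finite.axiom (undup s).
  by move=> x; rewrite count_uniq_mem ?undup_uniq // sP.
(* The group structure is kept and only finiteness is added, so [F] and [G] agree by conversion, not
   merely up to isomorphism. *)
pose F : finGroupType :=
  HB.pack (Group.sort G) (PCanIsCountable cT) (isFinite.Build _ fT).
by exists F.
Qed.

End GeneratedSubgroups.

Lemma group_isomorphic_sym (G K : groupType) :
  group_isomorphic G K -> group_isomorphic K G.
Proof.
case=> f [g fK gK] fM; exists g; first by exists f.
by move=> x y; rewrite -[in LHS](gK x) -[in LHS](gK y) -fM fK.
Qed.

(** * Cocyclicity in a finite group *)

Section CocyclicFinite.
Variable gT : finGroupType.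
Implicit Types x y z c : gT.

Definition cocyclicb x y : bool := [exists z, (x \in <[z]>) && (y \in <[z]>)].

Lemma cocyclicbP x y :
  reflect (exists2 z, x \in <[z]> & y \in <[z]>) (cocyclicb x y).
Proof.
by apply: (iffP existsP) => -[z]; [case/andP; exists z | exists z; apply/andP].
Qed.

Lemma cocyclicb_sym x y : cocyclicb x y = cocyclicb y x.
Proof. by apply: eq_existsb => z; rewrite andbC. Qed.

Lemma cocyclicb_cycle x y u v :
  cocyclicb x y -> u \in <[x]> -> v \in <[y]> -> cocyclicb u v.
Proof.
case/cocyclicbP=> z xz yz ux vy; apply/cocyclicbP; exists z.
  by apply: subsetP ux; rewrite cycle_subG.
by apply: subsetP vy; rewrite cycle_subG.
Qed.

Lemma cocyclicb_commute x y : cocyclicb x y -> commute x y.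
Proof.
case/cocyclicbP=> z /cycleP[i ->] /cycleP[j ->].
exact: commuteX2.
Qed.

Definition cyc_center : {set gT} := [set x | [forall y, cocyclicb x y]]%SET.

Lemma cyc_centerP x : reflect (forall y, cocyclicb x y) (x \in cyc_center).
Proof. by rewrite inE; apply: forallP. Qed.

(** Given u, first some cyclic <z> contains y and u, then some cyclic <w> contains x and z; this <w>
    contains x y and u. *)
Lemma cyc_center_group_set : group_set cyc_center.
Proof.
apply/group_setP; split=> [|x y /cyc_centerP xZ /cyc_centerP yZ].
  by apply/cyc_centerP => y; apply/cocyclicbP; exists y;
    rewrite ?group1 ?cycle_id.
apply/cyc_centerP => u; have /cocyclicbP[z yz uz] := yZ u.
have /cocyclicbP[w xw zw] := xZ z.
have sub : <[z]> \subset <[w]> by rewrite cycle_subG.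
apply/cocyclicbP; exists w; last exact: subsetP uz.
by rewrite groupM // (subsetP sub).
Qed.

Canonical cyc_center_group := Group cyc_center_group_set.

Lemma cyc_center_central : cyc_center \subset 'Z([set: gT]).
Proof.
apply/subsetP => x /cyc_centerP xZ; apply/centerP; split=> [|y _].
  by rewrite inE.
exact: cocyclicb_commute.
Qed.

(** Take x of maximal order in H. For y in H, the group generated by x and y is cyclic, with a
    generator w in H, and maximality gives <x> = <w>, which contains y. *)
Lemma cyclic_cocyclicb (H : {group gT}) :
  {in H &, forall x y, cocyclicb x y} -> cyclic H.
Proof.
move=> cocH; case: (arg_maxnP (fun x => #[x]) (group1 H)) => x Hx0 xmax.
have Hx : x \in H := Hx0.
apply/cyclicP; exists x; apply/eqP; rewrite eqEsubset cycle_subG Hx andbT.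
apply/subsetP => y Hy; have /cocyclicbP[z xz yz] := cocH _ _ Hx Hy.
have sub : <<[set x; y]%SET>> \subset <[z]>.
  by rewrite gen_subG; apply/subsetP => u /set2P[] ->.
have /cyclicP[w defw] := cyclicS sub (cycle_cyclic z).
have Hw : w \in H.
  have: w \in <<[set x; y]%SET>> by rewrite defw cycle_id.
  by apply: subsetP; rewrite gen_subG; apply/subsetP => u /set2P[] ->.
have xw : <[x]> \subset <[w]>.
  by rewrite cycle_subG; have := mem_gen (set21 x y); rewrite defw.
have /eqP-> : <[x]> == <[w]> by rewrite eqEcard xw; apply: xmax.
by have := mem_gen (set22 x y); rewrite defw.
Qed.

Lemma cyc_center_cyclic : cyclic cyc_center.
Proof. by apply: cyclic_cocyclicb => x y /cyc_centerP xZ _. Qed.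

Hypothesis cocyclicb_trans :
  forall x y z, y \notin cyc_center ->
    cocyclicb x y -> cocyclicb y z -> cocyclicb x z.

(** Transitivity through x puts y1 and y2 in one cyclic <z>. If one of them is not in [cyc_center],
    transitivity through it makes x cocyclic with z, hence with y1 y2; otherwise y1 y2 is in
    [cyc_center]. *)
Lemma cocyclicb_group_set x :
  x \notin cyc_center -> group_set [set y | cocyclicb x y]%SET.
Proof.
move=> xnZ; apply/group_setP; split=> [|y1 y2].
  by rewrite inE cocyclicb_sym; apply/cyc_centerP; apply: group1.
rewrite !inE => xy1 xy2.
have /cocyclicbP[z y1z y2z] : cocyclicb y1 y2.
  by apply: cocyclicb_trans xnZ _ xy2; rewrite cocyclicb_sym.
have aux y : y \in <[z]> -> y \notin cyc_center -> cocyclicb x y ->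
    cocyclicb x (y1 * y2).
  move=> yz ynZ xy; have xz : cocyclicb x z.
    apply: cocyclicb_trans ynZ xy _; apply/cocyclicbP.
    by exists z; rewrite ?cycle_id.
  by apply: cocyclicb_cycle xz (cycle_id x) _; apply: groupM.
have [y1Z|y1nZ] := boolP (y1 \in cyc_center); last exact: aux y1z y1nZ xy1.
have [y2Z|y2nZ] := boolP (y2 \in cyc_center); last exact: aux y2z y2nZ xy2.
by rewrite cocyclicb_sym; apply/cyc_centerP; apply: groupM.
Qed.

End CocyclicFinite.

(** * Recovering the direct sum from the order of the group and of its center Z *)

Section DirectSum.
Variables (gT : finGroupType) (p n : nat) (Z : {group gT}).
Hypotheses (p_prime : prime p) (n_gt0 : 0 < n) (coprime_n_p : coprime n p).
Hypotheses (cycZ : cyclic Z) (sZZ : Z \subset 'Z([set: gT])) (oZ : #|Z| = n).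
Hypotheses (oG : #|gT| = (p ^ 2 * n)%N) (ncycG : ~~ cyclic [set: gT]).

Lemma exists_direct_basis : exists a b c : gT,
  [/\ #[a] = p, #[b] = p, #[c] = n,
    (forall x, commute c x) & commute a b /\ <[a]> \x <[b]> \x <[c]> = setT].
Proof.
have [P sylP] := Sylow_exists p [set: gT].
have oP : #|P| = (p ^ 2)%N.
  rewrite (card_Hall sylP) cardsT oG p_part.
  rewrite lognM ?expn_gt0 ?(prime_gt0 p_prime) //.
  by rewrite pfactorK // logn_coprime ?addn0 // coprime_sym.
have cPZ : coprime #|P| #|Z| by rewrite oP oZ coprime_sym coprimeXr.
(* P and Z have coprime orders with product |G|, and Z is central. *)
have PZ : P \x Z = setT.
  rewrite dprodE ?coprime_TIg //; last first.
    by apply: subset_trans sZZ _; rewrite subIset // centS ?orbT ?subsetT.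
  apply/eqP; rewrite eqEcard subsetT (TI_cardMg (coprime_TIg cPZ)) oP oZ.
  by rewrite cardsT oG leqnn.
have ncycP : ~~ cyclic P.
  by apply: contra ncycG => cycP; rewrite (cyclic_dprod PZ).
have abP : abelian P by apply: card_p2group_abelian oP.
(* An element of order p^2 would generate P, which is not cyclic. *)
have ordP x : x \in P -> x != 1 -> #[x] = p.
  move=> Px nt_x; have: #[x] %| (p ^ 2)%N by rewrite -oP order_dvdG.
  case/dvdn_pfactor => // -[|[|[|i]]] // _ ox.
  - by move/eqP: ox; rewrite order_eq1 (negPf nt_x).
  - case/negP: ncycP; apply/cyclicP; exists x; apply/eqP.
    by rewrite eq_sym eqEcard cycle_subG Px oP -ox /order /=.
have [a Pa nt_a] : exists2 a, a \in P & a != 1.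
  by apply/trivgPn; apply: contra ncycP => /eqP->; apply: cyclic1.
have [b Pb nab] : exists2 b, b \in P & b \notin <[a]>.
  apply/subsetPn; apply: contra ncycP => sPa; apply: cyclicS sPa _.
  exact: cycle_cyclic.
have oa := ordP a Pa nt_a.
have ob : #[b] = p by apply: ordP => //; apply: contraNneq nab => ->.
have [c defZ] := cyclicP cycZ.
have cab : commute a b by apply: (centsP abP).
(* <b> has prime order and is not contained in <a>. *)
have tiab : <[a]> :&: <[b]> = 1.
  by rewrite setIC prime_TIg ?cycle_subG // -orderE ob.
have defP : <[a]> \x <[b]> = P.
  rewrite dprodE // ?cent_cycle ?cycle_subG //; last by apply/cent1P.
  apply/eqP; rewrite eqEcard mul_subG ?cycle_subG //.
  by rewrite (TI_cardMg tiab) -!orderE oa ob oP mulnn leqnn.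
exists a, b, c; split=> //; first by rewrite orderE -defZ.
  move=> x; have : c \in 'Z([set: gT]).
    by apply: (subsetP sZZ); rewrite defZ cycle_id.
  by case/centerP=> _; apply.
by rewrite defP -defZ.
Qed.

End DirectSum.

Lemma direct_basis_isomorphic (gT : finGroupType) (p n : nat) (a b c : gT) :
  #[a] = p.+1 -> #[b] = p.+1 -> #[c] = n.+1 ->
  commute a b -> (forall x, commute c x) ->
  <[a]> \x <[b]> \x <[c]> = setT ->
  group_isomorphic gT (Zmod p.+1 * Zmod p.+1 * Zmod n.+1)%type.
Proof.
move=> oa ob oc cab cc defG; apply: group_isomorphic_sym.
pose f (u : 'I_p.+1 * 'I_p.+1 * 'I_n.+1) : gT :=
  a ^+ u.1.1 * b ^+ u.1.2 * c ^+ u.2.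
have oG : #|gT| = (p.+1 * p.+1 * n.+1)%N.
  have [[P _ defP _] _ _ _] := dprodP defG.
  rewrite -cardsT -(dprod_card defG) defP -(dprod_card defP) -!orderE.
  by rewrite oa ob oc.
have fM (u v : Zmod p.+1 * Zmod p.+1 * Zmod n.+1) : f (u * v) = f u * f v.
  case: u => [[i j] k]; case: v => [[i' j'] k'].
  have -> : f ((i, j, k) * (i', j', k')) =
     a ^+ ((i + i') %% p.+1)%N * b ^+ ((j + j') %% p.+1)%N *
     c ^+ ((k + k') %% n.+1)%N by [].
  have modX x m l : #[x] = m -> x ^+ (l %% m)%N = x ^+ l :> gT.
    by move=> <-; rewrite expg_mod_order.
  rewrite !modX // !expgnDr /f /=.
  transitivity (a ^+ i * b ^+ j * (a ^+ i' * b ^+ j') * (c ^+ k * c ^+ k')).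
    congr (_ * _); rewrite -!mulgA; congr (_ * _).
    rewrite !mulgA; congr (_ * _).
    exact: commuteX2.
  rewrite -[LHS]mulgA -[RHS]mulgA; congr (_ * _); rewrite !mulgA; congr (_ * _).
  by rewrite -[RHS]mulgA; apply: (commuteX k (commute_sym (cc _))).
have f_surj g : exists u, f u = g.
  have : g \in setT by [].
  have [[P _ defP _] _ _ _] := dprodP defG.
  rewrite -(dprodW defG) defP -(dprodW defP).
  case/mulsgP => _ _ /mulsgP[_ _ /cyclePmin[i lti ->] /cyclePmin[j ltj ->] ->]
    /cyclePmin[k ltk ->] ->.
  rewrite oa in lti; rewrite ob in ltj; rewrite oc in ltk.
  by exists (Ordinal lti, Ordinal ltj, Ordinal ltk).
(* A section of f is injective between sets of equal size, hence bijective, and so is f. *)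
have [g fgK] := choice f_surj.
exists f => //; apply: (bij_can_bij _ fgK).
apply: inj_card_bij (can_inj fgK) _.
by rewrite oG !card_prod !card_ord.
Qed.

(** When x is a vertex and cocyclicity is transitive on vertices, this is the part of the
    multipartite graph that contains x. *)
Definition cocyclicb_class (gT : finGroupType) (x : gT) : {set gT} :=
  [set y in ~: cyc_center gT | cocyclicb x y]%SET.

Lemma card_cocyclicb (gT : finGroupType) (x : gT) :
  #|[set y | cocyclicb x y]%SET| = (#|cyc_center gT| + #|cocyclicb_class x|)%N.
Proof.
rewrite -(cardsID (cyc_center gT)); congr (_ + _)%N; apply: eq_card => y.
  rewrite !inE andb_idl // => /forallP yZ.
  by rewrite cocyclicb_sym.
by rewrite !inE.
Qed.

(** The hypotheses are the data read off the graph: complete multipartite shape, size of each part,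
    number of vertices. *)
Lemma multipartite_isomorphic (gT : finGroupType) (p n : nat) :
    prime p -> 0 < n -> coprime n p ->
    (forall x y z : gT, y \notin cyc_center gT ->
       cocyclicb x y -> cocyclicb y z -> cocyclicb x z) ->
    (forall x, x \notin cyc_center gT -> #|cocyclicb_class x| = (p.-1 * n)%N) ->
    #|~: cyc_center gT| = ((p ^ 2).-1 * n)%N ->
  group_isomorphic gT (Zmod p * Zmod p * Zmod n)%type.
Proof.
move=> p_prime n_gt0 co_np tr card_class card_nZ.
set Z := cyc_center_group gT.
have p_gt1 := prime_gt1 p_prime.
have oG : #|gT| = (#|Z| + (p ^ 2).-1 * n)%N by rewrite -card_nZ cardsC.
have [x xnZ] : exists x, x \notin Z.
  have: 0 < #|~: Z|.
    by rewrite card_nZ muln_gt0 n_gt0 andbT -subn1 subn_gt0 (ltn_exp2l 0).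
  by case/card_gt0P=> x; rewrite inE; exists x.
pose C := Group (cocyclicb_group_set tr xnZ).
have sZC : Z \subset C.
  by apply/subsetP => y /cyc_centerP yZ; rewrite inE cocyclicb_sym.
have oC : #|C| = (#|Z| + p.-1 * n)%N.
  by rewrite -(card_class x xnZ) -card_cocyclicb.
(* Lagrange's theorem for Z in C and for C in G. *)
have oZ : #|Z| = n.
  apply: (card_center_eq p_prime) => //.
    by rewrite -oC cardSg.
  by rewrite -oC -oG -cardsT cardSg ?subsetT.
have oG2 : #|gT| = (p ^ 2 * n)%N.
  by rewrite oG oZ -mulSn prednK ?expn_gt0 ?(ltnW p_gt1).
have ncycG : ~~ cyclic [set: gT].
  apply/negP=> /cyclicP[z defG]; have /negP[] := xnZ; apply/cyc_centerP => y.
  by apply/cocyclicbP; exists z; rewrite -defG inE.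
have [a [b [c [oa ob oc cc [cab defG]]]]] :=
  exists_direct_basis p_prime n_gt0 co_np (cyc_center_cyclic gT)
    (cyc_center_central gT) oZ oG2 ncycG.
(* With p and n written as successors, [Zmod] reduces to the plain ordinal types; orders of elements
   being positive, the zero cases are void. *)
case: p n {p_prime n_gt0 co_np card_class card_nZ p_gt1 oG oC oZ oG2} oa ob oc
  => [|p] [|n] oa ob oc;
  do ?by have := order_gt0 a; rewrite oa.
  by have := order_gt0 c; rewrite oc.
exact: direct_basis_isomorphic oa ob oc cab cc defG.
Qed.

(** * The non-cyclic graph of Z_p + Z_p + Z_n, by linear algebra over F_p *)

Section Model.
Variables p' n' : nat.
Local Notation p := p'.+2.
Local Notation n := n'.+1.
Hypotheses (p_prime : prime p) (coprime_n_p : coprime n p).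

(* Convertible, as a [groupType], to [Zmod p * Zmod p * Zmod n], but with the
   coordinates in the ring ['I_p'.+2]. *)
Definition model : finGroupType := ('I_p * 'I_p * 'I_n)%type.

Lemma model_expg (x : model) k :
  x ^+ k = (x.1.1 *+ k, x.1.2 *+ k, x.2 *+ k)%R.
Proof.
elim: k => [|k IHk] //; rewrite expgS IHk !GRing.mulrS.
by [].
Qed.

Lemma nonzero_unit (x : 'I_p) : x != 0%R -> x \is a GRing.unit.
Proof.
move=> nz_x; have := unitZpE x (isT : 1 < p); rewrite natr_Zp => ->.
by rewrite prime_coprime // gtnNdvd // lt0n.
Qed.

(** The exponent is congruent to t mod p and to d mod n. Thus one cyclic subgroup contains a whole
    line of F_p^2 times Z_n; [inZp 1] generates Z_n, also for n = 1. *)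
Lemma chinese_model (u1 u2 t : 'I_p) (d : 'I_n) :
  ((t * u1, t * u2, d)%R : model) \in <[((u1, u2, inZp 1) : model)]>.
Proof.
set i := chinese p n t d; have co_pn : coprime p n by rewrite coprime_sym.
have ti : t = (i%:R)%R :> 'I_p.
  by apply: val_inj; rewrite Zp_nat /= chinese_modl // modn_small.
apply/cycleP; exists i; rewrite model_expg /= ti !GRing.mulr_natl.
congr (_, _); apply: val_inj; rewrite Zp_mulrn /= modnMml mul1n.
by rewrite chinese_modr // modn_small.
Qed.

Lemma proportional (x1 x2 y1 y2 : 'I_p) : ((x1, x2) != (0, 0) ->
  x1 * y2 = x2 * y1 -> exists t, y1 = t * x1 /\ y2 = t * x2)%R.
Proof.
move=> nz_x eq_xy; have [x1_0|/nonzero_unit Ux1] := eqVneq x1 0%R; last first.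
  exists (y1 / x1)%R; rewrite GRing.divrK //; split=> //.
  apply: (GRing.mulrI Ux1); rewrite eq_xy -[in LHS](GRing.divrK Ux1 y1); ring.
have [x2_0|/nonzero_unit Ux2] := eqVneq x2 0%R.
  by rewrite x1_0 x2_0 eqxx in nz_x.
exists (y2 / x2)%R; rewrite GRing.divrK //; split=> //.
apply: (GRing.mulrI Ux2); rewrite -eq_xy -[in LHS](GRing.divrK Ux2 y2); ring.
Qed.

(** The determinant of two multiples of one vector vanishes. Conversely, a zero determinant puts
    both vectors on one line, and [chinese_model] applies. *)
Lemma model_cocyclicbE (x y : model) :
  cocyclicb x y = (x.1.1 * y.1.2 == x.1.2 * y.1.1)%R.
Proof.
apply/cocyclicbP/eqP => [[z /cycleP[i ->] /cycleP[j ->]]|].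
  by rewrite !model_expg /= !GRing.mulrnAl !GRing.mulrnAr (GRing.mulrC z.1.1).
case: x y => [[x1 x2] c] [[y1 y2] d] /= eq_xy.
(* The line is spanned by the vector of x, or by that of y if the former is zero. *)
have [[z1 z2] [t [s [-> -> -> ->]]]] :
    exists (u : 'I_p * 'I_p) (t s : 'I_p),
   [/\ x1 = t * u.1, x2 = t * u.2, y1 = s * u.1 & y2 = s * u.2]%R.
  have [[-> ->]|nz_x] := eqVneq (x1, x2) (0, 0)%R.
    by exists (y1, y2), 0%R, 1%R; split; rewrite ?GRing.mul1r ?GRing.mul0r.
  have [t [-> ->]] := proportional nz_x eq_xy.
  by exists (x1, x2), 1%R, t; split; rewrite ?GRing.mul1r.
by exists (z1, z2, inZp 1); apply: chinese_model.
Qed.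

Lemma model_centerE (x : model) : (x \in cyc_center model) = (x.1 == (0, 0)%R).
Proof.
apply/cyc_centerP/eqP => [xZ|x0 y]; last first.
  by rewrite model_cocyclicbE x0 /= !GRing.mul0r.
(* The determinants against the two basis vectors are the coordinates of x, up to sign. *)
have := xZ (0, 1, 0)%R; have := xZ (1, 0, 0)%R.
rewrite !model_cocyclicbE /= !GRing.mulr1 !GRing.mulr0 => /eqP x2_0 /eqP x1_0.
by case: x {xZ} x1_0 x2_0 => [[x1 x2] c] /= -> <-.
Qed.

(** The determinant of x and z vanishes after multiplication by a nonzero coordinate of y, which is
    a unit. *)
Lemma model_cocyclicb_trans (x y z : model) :
  y \notin cyc_center model ->
    cocyclicb x y -> cocyclicb y z -> cocyclicb x z.
Proof.
rewrite model_centerE !model_cocyclicbE => nz_y /eqP xy /eqP yz; apply/eqP.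
have [y1_0|/nonzero_unit Uy1] := eqVneq y.1.1 0%R; last first.
  apply: (GRing.mulrI Uy1); ring: xy yz.
have [y2_0|/nonzero_unit Uy2] := eqVneq y.1.2 0%R.
  by case/eqP: nz_y; case: (y) y1_0 y2_0 => [[y1 y2] c] /= -> ->.
by apply: (GRing.mulrI Uy2); ring: xy yz.
Qed.

Lemma card_model_center : #|cyc_center model| = n.
Proof.
rewrite -[RHS]card_ord.
rewrite -(card_imset _ (f := fun d : 'I_n => ((0, 0, d)%R : model))).
  apply: eq_card => x; rewrite model_centerE.
  apply/eqP/imsetP => [|[d _ ->] //].
  by case: x => [u d] /= ->; exists d.
by move=> d d' [].
Qed.

Lemma card_model_cocyclicb (x : model) : x \notin cyc_center model ->
  #|[set y | cocyclicb x y]%SET| = (p * n)%N.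
Proof.
rewrite model_centerE => nz_x.
(* This parametrizes the line of x times Z_n, injectively since x has a unit coordinate. *)
pose f (u : 'I_p * 'I_n) : model := ((u.1 * x.1.1, u.1 * x.1.2, u.2)%R).
have <- : #|f @: setT| = (p * n)%N.
  rewrite card_imset ?cardsT ?card_prod ?card_ord //.
  move=> [t d] [t' d'] eq_f; congr (_, _); last exact: (congr1 snd eq_f).
  have eq1 : (t * x.1.1 = t' * x.1.1)%R := congr1 (fun z : model => z.1.1) eq_f.
  have eq2 : (t * x.1.2 = t' * x.1.2)%R := congr1 (fun z : model => z.1.2) eq_f.
  have [x1_0|/nonzero_unit Ux1] := eqVneq x.1.1 0%R; last first.
    exact: (GRing.mulIr Ux1 eq1).
  have [x2_0|/nonzero_unit Ux2] := eqVneq x.1.2 0%R; last first.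
    exact: (GRing.mulIr Ux2 eq2).
  by move: nz_x; rewrite [x.1]surjective_pairing x1_0 x2_0 eqxx.
apply: eq_card => y; rewrite inE model_cocyclicbE.
apply/eqP/imsetP => [|[[t d] _ ->] /=]; last by ring.
case: x y nz_x @f => [[x1 x2] c] [[y1 y2] d] nz_x f /= eq_xy.
by have [t [-> ->]] := proportional nz_x eq_xy; exists (t, d).
Qed.

Lemma card_model_class (x : model) : x \notin cyc_center model ->
  #|cocyclicb_class x| = (p.-1 * n)%N.
Proof.
move=> xnZ; have := card_cocyclicb x.
rewrite (card_model_cocyclicb xnZ) card_model_center.
by rewrite mulSn => /addnI ->.
Qed.

Lemma card_model_noncenter : #|~: cyc_center model| = ((p ^ 2).-1 * n)%N.
Proof.
apply/eqP; rewrite -(eqn_add2l #|cyc_center model|) cardsC card_model_center.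
by rewrite -mulSn prednK // !card_prod !card_ord.
Qed.

End Model.

(** * Passing between the graph, arbitrary groups and finite groups *)

Lemma gen_subgroup1_finite (gT : finGroupType) (x z : gT) :
  gen_subgroup [set z]%classic x <-> x \in <[z]>.
Proof.
rewrite gen_subgroup1E; split=> [[k [->|->]]|/cycleP[k ->]].
- exact: mem_cycle.
- by rewrite groupV mem_cycle.
- by exists k; left.
Qed.

Lemma cocyclic_finite (gT : finGroupType) (x y : gT) :
  cocyclic x y <-> cocyclicb x y.
Proof.
split=> [[z [/gen_subgroup1_finite xz /gen_subgroup1_finite yz]]|].
  by apply/cocyclicbP; exists z.
by case/cocyclicbP=> z xz yz; exists z; split; apply/gen_subgroup1_finite.
Qed.

Lemma Cyc_cocyclicE (G : groupType) :
  Cyc G = [set x | forall y, cocyclic x y]%classic.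
Proof.
by apply/seteqP; split=> x xC y; apply/cyclic_gen2P; apply: xC.
Qed.

Lemma Cyc_finite (gT : finGroupType) (x : gT) :
  Cyc gT x <-> x \in cyc_center gT.
Proof.
rewrite Cyc_cocyclicE; split=> [xC|/cyc_centerP xZ y]; last first.
  exact/cocyclic_finite.
by apply/cyc_centerP => y; apply/cocyclic_finite.
Qed.

Lemma cocyclic_morph (G K : groupType) (f : G -> K) (x y : G) :
  {morph f : x y / x * y} -> cocyclic x y -> cocyclic (f x) (f y).
Proof.
move=> fM [z]; rewrite gen_subgroup1E => -[[k xk] [l yl]].
have f1 : f 1 = 1 by apply: (mulgI (f 1)); rewrite -fM !mulg1.
have fX u i : f (u ^+ i) = f u ^+ i.
  by elim: i => // i IHi; rewrite !expgS fM IHi.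
have fV u : f u^-1 = (f u)^-1 by apply: (mulgI (f u)); rewrite -fM !mulgV.
exists (f z); rewrite gen_subgroup1E; split; [exists k | exists l].
  by case: xk => ->; rewrite ?fV fX; [left | right].
by case: yl => ->; rewrite ?fV fX; [left | right].
Qed.

Lemma not_locally_cyclic (G : groupType) (x y : G) :
  ~ cocyclic x y -> ~ locally_cyclic G.
Proof.
move=> ncxy lcG; apply: ncxy; apply/cyclic_gen2P; apply: lcG.
  exact: gen_subgroupP.
by exists [set x; y]%classic => //; apply: finite_set2.
Qed.

(** Distinctness comes for free, since every element is cocyclic with itself. *)
Lemma adj_cocyclic (G : groupType) (x y : noncyclic_graph G) :
  adj x y <-> ~ cocyclic (val x) (val y).
Proof.
split=> [[_ ncxy] /cyclic_gen2P //|ncxy]; split=> [eq_xy|/cyclic_gen2P//].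
apply: ncxy; rewrite eq_xy.
by exists (val y); split; apply: sub_gen_smallest.
Qed.

(** A group isomorphism preserves and reflects cocyclicity, so it restricts to vertices; the pair x,
    y and its image in G show that neither group is locally cyclic. *)
Lemma isomorphic_noncyclic_graph (G K : groupType) (x y : K) :
  ~ cocyclic x y -> group_isomorphic G K -> noncyclic_graph_isomorphic G K.
Proof.
move=> ncxy isoGK; have [g [h gK hK] gM] := group_isomorphic_sym isoGK.
have hM : {morph h : x y / x * y}.
  by move=> u v; rewrite -{1}[u]hK -{1}[v]hK -gM gK.
have cocycg u v : cocyclic (g u) (g v) <-> cocyclic u v.
  split; last exact: cocyclic_morph.
  by rewrite -{2}[u]gK -{2}[v]gK; apply: cocyclic_morph.
have cocych u v : cocyclic (h u) (h v) <-> cocyclic u v.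
  by rewrite -cocycg !hK.
have nch u : u \in (~` Cyc G)%classic -> h u \in (~` Cyc K)%classic.
  rewrite !in_setE !Cyc_cocyclicE => nCu Chu; apply: nCu => v.
  by apply/cocych; apply: Chu.
have ncg u : u \in (~` Cyc K)%classic -> g u \in (~` Cyc G)%classic.
  rewrite !in_setE !Cyc_cocyclicE => nCu Cgu; apply: nCu => v.
  by apply/cocycg; apply: Cgu.
split; [|exact: not_locally_cyclic ncxy |].
  by apply: (@not_locally_cyclic _ (g x) (g y)); rewrite cocycg.
pose h' (u : noncyclic_graph G) : noncyclic_graph K :=
  exist _ (h (val u)) (nch _ (valP u)).
pose g' (u : noncyclic_graph K) : noncyclic_graph G :=
  exist _ (g (val u)) (ncg _ (valP u)).
exists h'; first exists g'.
  - by move=> u; apply: val_inj; rewrite /= hK.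
  - by move=> u; apply: val_inj; rewrite /= gK.
by move=> u v; rewrite !adj_cocyclic /= cocych.
Qed.

(** Some cyclic <z> contains x y and u, and some cyclic <w> contains y and z; so <w> contains x and
    u. It follows that right translation by [Cyc G] sends vertices to vertices. *)
Lemma Cyc_divr (G : groupType) (x y : G) : Cyc G y -> Cyc G (x * y) -> Cyc G x.
Proof.
rewrite Cyc_cocyclicE => yC xyC u; have [z [zxy zu]] := xyC u.
have [w [wy wz]] := yC z.
exists w; have sgw := gen_subgroupP [set w]%classic.
have szw : (gen_subgroup [set z] `<=` gen_subgroup [set w])%classic.
  by apply: smallest_sub => // _ ->.
split; last exact: szw.
rewrite -[x](mulgK y); apply: (subgroupM sgw); first exact: szw.
exact: (subgroupV sgw).
Qed.

Lemma noncyclic_graph_finite (G : groupType) (kT : finGroupType)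
    (x : noncyclic_graph G) :
  graph_isomorphic (noncyclic_graph G) (noncyclic_graph kT) ->
  finite_set [set: G]%classic.
Proof.
case=> f [g fK gK] _.
have finV : finite_set (~` Cyc G)%classic.
  pose h (k : kT) : G := if insub k is Some v then val (g v) else 1.
  apply: (@sub_finite_set _ _ (range h)); last exact/finite_image/finite_finset.
  move=> u nCu; pose v : noncyclic_graph G := exist _ u (mem_set nCu).
  by exists (val (f v)) => //; rewrite /h valK fK.
rewrite -(setvU (Cyc G)) finite_setU; split=> //.
(* The coset x Cyc(G) consists of vertices, so Cyc(G) lies in a translate of the finite vertex
   set. *)
apply: (@sub_finite_set _ _ ((fun u => (val x)^-1 * u) @` (~` Cyc G))%classic);
  last exact: finite_image.
move=> c Cc; exists (val x * c); last by rewrite mulKg.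
by move=> /(Cyc_divr Cc); have := valP x; rewrite in_setE.
Qed.

Lemma noncyclic_graph_isomorphic_map (gT kT : finGroupType) :
  graph_isomorphic (noncyclic_graph gT) (noncyclic_graph kT) ->
  exists F : gT -> kT,
   [/\ {in ~: cyc_center gT &, injective F},
       F @: (~: cyc_center gT) = ~: cyc_center kT &
       {in ~: cyc_center gT &,
         forall x y, cocyclicb (F x) (F y) = cocyclicb x y}].
Proof.
case=> f [g fK gK] f_adj.
have VP (hT : finGroupType) (x : hT) :
  x \in ~: cyc_center hT -> exists v : noncyclic_graph hT, val v = x.
  rewrite inE => /negP xnZ; have nCx : (~` Cyc hT)%classic x by move/Cyc_finite.
  by exists (exist _ x (mem_set nCx)).
have valV (hT : finGroupType) (v : noncyclic_graph hT) :
    val v \in ~: cyc_center hT.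
  by rewrite inE; apply/negP => /Cyc_finite; have := valP v; rewrite in_setE.
(* The value 1 off the vertices is arbitrary; it makes [F] total, so that images of finite sets can
   be counted. *)
pose F (x : gT) : kT := if insub x is Some v then val (f v) else 1.
have FE v : F (val v) = val (f v) by rewrite /F valK.
exists F; split.
- move=> _ _ /VP[u <-] /VP[v <-]; rewrite !FE => /val_inj eq_f.
  by rewrite -[u]fK -[v]fK eq_f.
- apply/setP=> y; apply/imsetP/idP => [[_ /VP[v <-] ->]|/VP[w <-]].
    by rewrite FE valV.
  by exists (val (g w)); rewrite ?valV // FE gK.
- move=> _ _ /VP[u <-] /VP[v <-]; rewrite !FE.
  have := f_adj u v; rewrite !adj_cocyclic !cocyclic_finite => fuv.
  case: fuv => fuv vfu.
  by apply/idP/idP => ?; apply: contraT => /negP; [move/fuv | move/vfu].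
Qed.

Theorem proposition7p8 (G : groupType) (p n : nat) (p_prime : prime p)
    (n_gt0 : 0 < n) (coprime_n_p : coprime n p) :
  noncyclic_graph_isomorphic G (Zmod p * Zmod p * Zmod n)%type <->
  group_isomorphic G (Zmod p * Zmod p * Zmod n)%type.
Proof.
case: p p_prime coprime_n_p => [|[|p']] // p_prime co_np.
case: n n_gt0 co_np => // n' _ co_np.
pose K := model p' n'.
change (noncyclic_graph_isomorphic G K <-> group_isomorphic G K).
have card_nZ := card_model_noncenter p_prime co_np.
split=> [[_ _ isoG]|]; last first.
  (* These two elements have determinant 1, so they are not cocyclic. *)
  apply: (@isomorphic_noncyclic_graph _ _ ((1, 0, 0)%R : K) ((0, 1, 0)%R : K)).
  by rewrite cocyclic_finite model_cocyclicbE.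
have [y ynZ] : exists y : K, y \in ~: cyc_center K.
  apply/card_gt0P; rewrite card_nZ muln_gt0 andbT -subn1 subn_gt0.
  by rewrite (ltn_exp2l 0).
have [f [g _ _] _] := isoG.
(* A vertex of the model is pulled back to G, as the finiteness argument needs a vertex to translate
   by. *)
have x : noncyclic_graph G.
  apply: g; exists y; apply/mem_set => /Cyc_finite; apply/negP.
  by rewrite inE in ynZ.
have [gT defG] := finite_groupType (noncyclic_graph_finite x isoG).
case: G / defG isoG {f g x} => isoG.
have [F [F_inj F_onto F_coc]] := noncyclic_graph_isomorphic_map isoG.
have VF z : z \in ~: cyc_center gT -> F z \in ~: cyc_center K.
  by move=> Vz; rewrite -F_onto imset_f.
apply: (multipartite_isomorphic p_prime (ltn0Sn n') co_np).
(* If x' or z' lies in the center the claim is immediate; otherwise [F] carries it to the model. *)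
- move=> x' y' z'; rewrite -finset.in_setC => Vy xy yz.
  have [/cyc_centerP //|] := boolP (x' \in cyc_center gT).
  rewrite -finset.in_setC => Vx.
  have [/cyc_centerP zZ|] := boolP (z' \in cyc_center gT).
    by rewrite cocyclicb_sym.
  rewrite -finset.in_setC => Vz; rewrite -F_coc //.
  apply: (model_cocyclicb_trans p_prime co_np (y := F y')); rewrite ?F_coc //.
  by rewrite -finset.in_setC VF.
- move=> x'; rewrite -finset.in_setC => Vx.
  (* [F] maps the class of x' bijectively onto the class of [F x']. *)
  rewrite -(card_model_class p_prime co_np (x := F x')) -?in_setC ?VF //.
  rewrite -(card_in_imset (f := F) (D := mem (cocyclicb_class x'))); last first.
    by move=> u v /setIdP[Vu _] /setIdP[Vv _]; apply: F_inj.
  apply: eq_card => w; apply/imsetP/setIdP => [[u /setIdP[Vu xu] ->]|[Vw xw]].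
    by rewrite VF // F_coc.
  move: Vw xw; rewrite -F_onto => /imsetP[u Vu ->]; rewrite F_coc // => xu.
  by exists u => //; apply/setIdP.
- by rewrite -card_nZ -F_onto card_in_imset.
Qed.
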